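(* Let $n\ge 8$ be an even integer and let $D_n$ be the augmented source arc-path on $n$ vertices (defined in the context). Then $$\mathrm{DIN}(D_n)=\frac{n^2}{2}+\left\lfloor \frac{n^2}{16}-\frac{n}{4}+\frac{1}{4}\right\rfloor-1 .$$
   Context: All digraphs are finite and simple; an arc $(u,v)$ has tail $u$ and head $v$. A directed intersection representation of a digraph $D=(V,A)$ is an assignment $\varphi$ of a nonempty subset $\varphi(v)\subseteq\mathcal{C}$ of a finite ground set $\mathcal{C}$ (the color set) to each vertex $v\in V$ such that, for all distinct $u,v\in V$, $(u,v)\in A$ if and only if $|\varphi(u)\cap\varphi(v)|\ge 1$ and $|\varphi(u)|<|\varphi(v)|$. Every acyclic digraph admits such a representation. The directed intersection number $\mathrm{DIN}(D)$ is the smallest cardinality of a ground set $\mathcal{C}$ for which $D$ admits a directed intersection representation. For $m\ge1$ write $[m]=\{1,\dots,m\}$. For even $n\ge 8$, the augmented source arc-path $D_n$ has vertex set $\{v_1,\dots,v_n\}$ and arc set consisting of: (i) the arcs $(v_1,v_{2i})$ for $i\in[n/2]$ and the arcs $(v_j,v_{j+1})$ for $j\in[n-1]$; (ii) additional arcs among the vertices $v_3,v_5,\dots,v_{n-1}$, as follows. If $\frac{n-2}{2}$ is even, let $X=\{v_3,v_5,\dots,v_{n/2}\}$ and $Y=\{v_{n/2+2},v_{n/2+4},\dots,v_{n-1}\}$ (odd indices only), and add all arcs $(x,y)$ with $x\in X$, $y\in Y$ except $(v_{n/2},v_{n/2+2})$. If $\frac{n-2}{2}$ is odd, let $X=\{v_3,v_5,\dots,v_{n/2+1}\}$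 and $Y=\{v_{n/2+3},v_{n/2+5},\dots,v_{n-1}\}$ (odd indices only), and add all arcs $(x,y)$ with $x\in X$, $y\in Y$ except $(v_{n/2+1},v_{n/2+3})$. *)

(* Defs.v *)
(* MathComp *)
From HB Require Import structures.
From mathcomp Require Import all_boot all_order all_algebra.
Set Implicit Arguments.
Unset Strict Implicit.
Unset Printing Implicit Defensive.

Record digraph := Digraph {
  vertex :> finType;
  arc : rel vertex;
  arc_irr : irreflexive arc
}.

Definition dir_int_rep (D : digraph) (C : finType) (phi : D -> {set C}) : Prop :=
  (forall v : D, phi v != set0) /\
  (forall u v : D, u != v ->
     (arc u v <-> 1 <= #|phi u :&: phi v| /\ #|phi u| < #|phi v|)).

(* [is_DIN D k] reads "DIN(D) = k"; it is a relation because a digraph with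
   a directed cycle has no representation. *)
Definition is_DIN (D : digraph) (k : nat) : Prop :=
  (exists (C : finType) (phi : D -> {set C}), #|C| = k /\ dir_int_rep phi) /\
  (forall (C : finType) (phi : D -> {set C}), dir_int_rep phi -> k <= #|C|).

(* The arcs below are given on the indices 1, ..., n of the vertices
   v_1, ..., v_n. *)

(* The largest index in X; the smallest one in Y is [lastX n + 2]. *)
Definition lastX (n : nat) : nat :=
  if odd ((n - 2) %/ 2) then n %/ 2 + 1 else n %/ 2.

Definition inX (n i : nat) : bool := [&& odd i, 3 <= i & i <= lastX n].

Definition inY (n i : nat) : bool := [&& odd i, lastX n + 2 <= i & i <= n - 1].

(* For 1 <= j <= n, [~~ odd j] says that j = 2i for some i in [n/2]. *)
Definition asap_arc (n i j : nat) : bool :=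
  [|| (i == 1) && ~~ odd j,
      j == i + 1
    | [&& inX n i, inY n j & (i, j) != (lastX n, lastX n + 2)]].

(* The ordinal i : 'I_n stands for the vertex v_{i+1}. *)
Definition asap_rel (n : nat) : rel 'I_n := fun i j => asap_arc n i.+1 j.+1.

Lemma asap_rel_irr (n : nat) : irreflexive (@asap_rel n).
Proof.
move=> i; rewrite /asap_rel /asap_arc; apply/negbTE; rewrite !negb_or.
apply/and3P; split.
- by case: (nat_of_ord i).
- by rewrite addn1 neq_ltn ltnSn.
apply/negP => /and3P [/and3P [_ _ le1] /and3P [_ le2 _] _].
by have := leq_trans le2 le1; rewrite addn2 ltnNge leqnSn.
Qed.

Definition asap (n : nat) : digraph := Digraph (@asap_rel_irr n).

(* Main.v *)
Require Import Defs.
From mathcomp Require Import all_boot all_order all_algebra.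
From mathcomp Require Import zify ring lra.
Import Order.TTheory GRing.Theory Num.Theory.
Set Implicit Arguments.
Unset Strict Implicit.
Unset Printing Implicit Defensive.
Local Open Scope nat_scope.

(** Write m = n/2. The path v_1 -> ... -> v_n forces the cardinals of the
    colour sets to increase strictly, so that, for i < j, the arc (v_i, v_j) is
    present exactly when the two sets meet: a representation is an intersection
    representation of the underlying graph, with increasing sizes.

    Lower bound ([asap_din_le]). The m even vertices are pairwise non-adjacent
    and all adjacent to v_1, so the set of v_1 has at least m colours, the set
    of v_j at least m + j - 1, and the disjoint sets of the even vertices use at
    least the sum of m + j - 1 over even j, that is 2 m^2 colours. The graph has
    no triangle (the arc from the last element of X to the first one of Y, which
    would close one with the even vertex in between, is left out), so no colour
    of an X-Y arc lies in the set of a third vertex. The |X||Y| - 1 arcs from X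
    to Y therefore need as many colours, distinct from one another and from
    those of the even vertices.

    Upper bound ([asap_repP]). The bound is reached when the set of v_j has
    exactly m + j - 1 colours and every colour belongs to an even vertex or to
    an X-Y arc. Give each even vertex v_j a private block of m + j - 1 colours.
    The vertex v_1 takes one colour of each block. An odd vertex v_j with
    3 <= j takes the colours of the X-Y arcs incident to it, one colour from the
    block before it, and the rest, at most m + j - 2 colours, from the block
    after it, whose m + j colours leave two for v_1 and v_{j+2}.

    Finally |X| and |Y| add up to m - 1 and differ by at most one, so
    |X||Y| = floor ((m - 1)^2 / 4), and (m - 1)^2 / 4 is the argument of the
    floor in the theorem ([floor_quarter]). *)

(** * Counting *)

Lemma sum_card_disjoint (I C : finType) (P : {pred I}) (F : I -> {set C})
    (B : {set C}) :
  {in P, forall i, F i \subset B} ->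
  {in P &, forall i j, i != j -> [disjoint F i & F j]} ->
  \sum_(i in P) #|F i| <= #|B|.
Proof.
move=> FB dis.
have -> : \sum_(i in P) #|F i| =
    \sum_(i in P) \sum_(c in B) (c \in F i).
  apply: eq_bigr => i Pi; rewrite -sum1_card big_mkcond [RHS]big_mkcond /=.
  apply: eq_bigr => c _; case: (boolP (c \in F i)) => [/(subsetP (FB i Pi)) ->|_] //.
  by case: ifP.
rewrite exchange_big /= -sum1_card; apply: leq_sum => c _.
case: (pickP (fun i => (i \in P) && (c \in F i))) => [i /andP[Pi ci]|no].
  rewrite (bigD1 i Pi) /= ci big1 // => j /andP[Pj nji].
  by rewrite (disjointFl (dis j i Pj Pi nji)).
by rewrite big1 // => i Pi; have := no i; rewrite Pi /= => ->.
Qed.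

Lemma card_ord_itv (N a b : nat) :
  b <= N -> #|[set k : 'I_N | a <= k < b]| = b - a.
Proof.
move=> bN; rewrite cardsE -sum1_card big_mkcond /=.
rewrite (eq_bigr (fun k : 'I_N => (a <= k < b) : nat)); last first.
  by move=> k; rewrite unfold_in; case: ifP.
rewrite -(big_mkord xpredT (fun k => (a <= k < b) : nat)).
suff -> : forall M, \sum_(0 <= k < M) (a <= k < b) = minn M b - a by lia.
elim=> [|M IH]; first by rewrite big_nil; lia.
by rewrite big_nat_recr //= IH; case: (boolP (a <= M < b)); lia.
Qed.

Lemma card_odd_itv (n a b : nat) : 0 < a -> b <= n ->
  #|[set i : 'I_n | [&& odd i.+1, a <= i.+1 & i.+1 <= b]]| = uphalf b - a./2.
Proof.
move=> a0 bn; rewrite cardsE -sum1_card big_mkcond /=.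
rewrite (eq_bigr
  (fun i : 'I_n => [&& odd i.+1, a <= i.+1 & i.+1 <= b] : nat)); last first.
  by move=> i _; rewrite unfold_in; case: ifP.
rewrite -(big_mkord xpredT
  (fun i => [&& odd i.+1, a <= i.+1 & i.+1 <= b] : nat)).
suff -> : forall M, \sum_(0 <= i < M) [&& odd i.+1, a <= i.+1 & i.+1 <= b]
    = uphalf (minn M b) - a./2 by congr (uphalf _ - _); lia.
elim=> [|M IH]; first by rewrite big_nil; lia.
rewrite big_nat_recr //= {}IH.
by case: (boolP [&& _, _ & _]); lia.
Qed.

Lemma sum_even_index (n : nat) (F : nat -> nat) : ~~ odd n ->
  \sum_(i < n | ~~ odd i.+1) F i = \sum_(a < n./2) F a.*2.+1.
Proof.
move=> hev; have e : n = n./2.*2 by lia.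
move: n./2 e => m -> {n hev}; elim: m => [|m IH]; first by rewrite !big_ord0.
rewrite big_mkcond doubleS !big_ord_recr -big_mkcond /= IH.
by rewrite odd_double /= addn0.
Qed.

Lemma card_sum_set (S T : finType) (P : pred S) (Q : pred T) :
  #|[set c : S + T | match c with inl s => P s | inr t => Q t end]|
  = #|[set s | P s]| + #|[set t | Q t]|.
Proof.
rewrite -!sum1_card big_sumType.
by congr (_ + _); apply: eq_bigl => x; rewrite !inE.
Qed.

(** * Arcs between X and Y *)

Definition xy_arc (n i j : nat) : bool :=
  [&& inX n i, inY n j & (i, j) != (lastX n, lastX n + 2)].

Lemma lastX_bounds n : 8 <= n -> ~~ odd n ->
  [/\ odd (lastX n), n./2 <= lastX n, lastX n <= n./2 + 1 & lastX n + 3 <= n].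
Proof. by move=> n8 ev; rewrite /lastX; case: ifP => e; split; lia. Qed.

Definition xy_set (n : nat) : {set 'I_n * 'I_n} :=
  [set e : 'I_n * 'I_n | xy_arc n e.1.+1 e.2.+1].

Definition incident (n : nat) (v : 'I_n) : {set 'I_n * 'I_n} :=
  [set e in xy_set n | (e.1 == v) || (e.2 == v)].

Lemma card_X (n : nat) (n_ge8 : 8 <= n) (n_even : ~~ odd n) :
  #|[set i : 'I_n | inX n i.+1]| = (lastX n)./2.
Proof.
by have [? ? ? ?] := lastX_bounds n_ge8 n_even; rewrite card_odd_itv //; lia.
Qed.

Lemma card_Y (n : nat) (n_ge8 : 8 <= n) (n_even : ~~ odd n) :
  #|[set i : 'I_n | inY n i.+1]| = n./2 - 1 - (lastX n)./2.
Proof.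
by have [? ? ? ?] := lastX_bounds n_ge8 n_even; rewrite card_odd_itv //; lia.
Qed.

Lemma card_xy_set (n : nat) (n_ge8 : 8 <= n) (n_even : ~~ odd n) :
  #|xy_set n|.+1 = (lastX n)./2 * (n./2 - 1 - (lastX n)./2).
Proof.
have [? ? ? ?] := lastX_bounds n_ge8 n_even.
rewrite -(card_Y n_ge8 n_even) -(card_X n_ge8 n_even) -cardsX.
have hx : (lastX n).-1 < n by lia.
have hy : (lastX n).+1 < n by lia.
(* The pair left out of X * Y; an ordinal is one less than the index. *)
rewrite [RHS](cardsD1 (Ordinal hx, Ordinal hy)) !inE /= /inX /inY.
rewrite (_ : _ && _ = true); last by lia.
rewrite add1n; congr _.+1; apply: eq_card => -[i j].
rewrite !inE /xy_arc !xpair_eqE -!val_eqE /= /inX /inY; lia.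
Qed.

(** The bound that matters is deg <= n/2 + v - 3 for a vertex of index v >= 3:
    it leaves an odd vertex at least one colour to take from the block after
    it. *)
Lemma card_incident (n : nat) (n_ge8 : 8 <= n) (n_even : ~~ odd n) (v : 'I_n) :
  #|incident v| <= n./2.
Proof.
have [? ? ? ?] := lastX_bounds n_ge8 n_even.
have [vX|vX] := boolP (inX n v.+1).
  apply: (@leq_trans #|setX [set v] [set i : 'I_n | inY n i.+1]|).
    apply/subset_leq_card/subsetP => -[i j].
    rewrite !inE /xy_arc /= => /andP[/and3P[iX jY _]].
    rewrite -!val_eqE /=; move: vX iX jY; rewrite /inX /inY; lia.
  by rewrite cardsX cards1 card_Y; lia.
apply: (@leq_trans #|setX [set i : 'I_n | inX n i.+1] [set v]|).
  apply/subset_leq_card/subsetP => -[i j].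
  rewrite !inE /xy_arc /= => /andP[/and3P[iX jY _]].
  case/orP => /eqP e; move: vX iX jY; rewrite e ?eqxx;
    by do 3![case: (inX _ _) => //].
by rewrite cardsX cards1 card_X; lia.
Qed.

(** An even vertex v_{i+1} contributes n/2 + i colours, each X-Y arc one
    more. *)
Definition asap_din (n : nat) : nat :=
  \sum_(i < n | ~~ odd i.+1) (n./2 + i) + #|xy_set n|.

Lemma asap_dinE (n : nat) (n_ge8 : 8 <= n) (n_even : ~~ odd n) :
  (asap_din n).+1 = 2 * n./2 ^ 2 + (lastX n)./2 * (n./2 - 1 - (lastX n)./2).
Proof.
rewrite /asap_din -addnS (card_xy_set n_ge8 n_even).
rewrite (sum_even_index (addn n./2) n_even).
congr (_ + _); rewrite big_split /= sum_nat_const card_ord.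
have -> : forall m, \sum_(a < m) a.*2.+1 = m ^ 2; last by lia.
by elim=> [|m IH]; rewrite ?big_ord0 // big_ord_recr /= IH; lia.
Qed.

(** * Lower bound *)

Lemma asap_arc_odd (n i j : nat) :
  odd i -> odd j -> asap_arc n i j = xy_arc n i j.
Proof.
rewrite /asap_arc /xy_arc => oi oj; rewrite oj andbF.
by rewrite (_ : (j == i + 1) = false) //; lia.
Qed.

(** The last clause, on which triangle-freeness rests, holds because j = i + 2 is
    possible only for the last element of X and the first one of Y, and this
    pair is left out. *)
Lemma xy_arcP (n i j : nat) : xy_arc n i j ->
  [/\ odd i, odd j, 3 <= i <= lastX n, lastX n + 2 <= j <= n - 1 & j != i + 2].
Proof.
by rewrite /xy_arc /inX /inY xpair_eqE => h; split; lia.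
Qed.

Lemma xy_arc_same_side (n i j : nat) :
  (i <= lastX n) = (j <= lastX n) -> ~~ xy_arc n i j.
Proof. by move=> e; apply/negP => /xy_arcP[_ _]; lia. Qed.

Lemma asap_arc_even_odd (n i j : nat) : ~~ odd i -> odd j -> 3 <= j ->
  asap_arc n i j || asap_arc n j i -> (j == i + 1) || (i == j + 1).
Proof.
move=> ei oj j3; rewrite /asap_arc /inX /inY oj (negbTE ei) /= !andbF /= !orbF.
lia.
Qed.

(** See the lower bound above: [cardB] counts the colours of the even vertices,
    and [cardE] those of the X-Y arcs among the others. *)
Lemma asap_din_le (n : nat) (n_ge8 : 8 <= n) (n_even : ~~ odd n)
    (C : finType) (phi : asap n -> {set C}) :
  dir_int_rep phi -> asap_din n <= #|C|.
Proof.
have [lo l1 l2 l3] := lastX_bounds n_ge8 n_even.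
move=> [phi0 phiE].
have arcP (u v : 'I_n) : u < v -> asap_arc n u.+1 v.+1 ->
    phi u :&: phi v != set0 /\ #|phi u| < #|phi v|.
  move=> uv a; have /phiE[+ _] : u != v by rewrite -val_eqE /=; lia.
  by rewrite -card_gt0; apply.
have sizeS (i : nat) (ilt : i < n) (Silt : i.+1 < n) :
    #|phi (Ordinal ilt)| < #|phi (Ordinal Silt)|.
  by apply: (arcP _ _ _ _).2 => //=; rewrite /asap_arc; lia.
(* Walking along the path gains at least one colour per step. *)
have size_ge (u v : 'I_n) : u <= v -> #|phi u| + (v - u) <= #|phi v|.
  case: u v => u un [v vn] /= uv.
  elim: v vn uv => [|v IH] vn uv.
    have -> : Ordinal un = Ordinal vn by apply: val_inj => /=; lia.
    by rewrite sub0n addn0.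
  have [e|ltuv] := eqVneq u v.+1.
    have -> : Ordinal un = Ordinal vn by apply: val_inj => /=; lia.
    by rewrite e subnn addn0.
  have vn' : v < n by lia.
  by have := IH vn' ltac:(lia); have := sizeS v vn' vn; lia.
(* The sizes are ordered, so a missing arc can only mean disjointness. *)
have nonarcP (u v : 'I_n) : u < v -> ~~ asap_arc n u.+1 v.+1 ->
    [disjoint phi u & phi v].
  move=> uv na; have ne : u != v by rewrite -val_eqE /=; lia.
  rewrite -setI_eq0 -[_ == _]negbK -card_gt0; apply: contra na => I0.
  apply/(phiE u v ne); split=> //.
  by have := size_ge u v (ltnW uv); lia.
pose P := [pred i : 'I_n | ~~ odd i.+1].
have disE : {in P &, forall u v : 'I_n, u != v -> [disjoint phi u & phi v]}.
  move=> u v; rewrite !inE -val_eqE /= => eu ev.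
  rewrite neq_ltn => /orP[] lt; last rewrite disjoint_sym;
    by apply: nonarcP => //; rewrite /asap_arc /inX /inY !xpair_eqE; lia.
have n0 : 0 < n by lia.
pose v1 : 'I_n := Ordinal n0.
(* v_1 meets n/2 pairwise disjoint sets. *)
have size1 : n./2 <= #|phi v1|.
  have <- : \sum_(i in P) 1 = n./2.
    by rewrite (sum_even_index (fun=> 1) n_even) sum_nat_const card_ord muln1.
  apply: leq_trans (sum_card_disjoint (F := fun i => phi v1 :&: phi i) _ _).
  - apply: leq_sum => i ei; rewrite card_gt0; apply: (arcP _ _ _ _).1 => /=;
      by move: ei; rewrite inE /asap_arc /=; lia.
  - by move=> i _; apply: subsetIl.
  - move=> i j ei ej nij; rewrite disjoint_sym; apply: disjointWl (subsetIr _ _) _.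
    by rewrite disjoint_sym; apply: disjointWl (subsetIr _ _) _; apply: disE.
pose B := \bigcup_(i in P) phi i.
have cardB : \sum_(i < n | ~~ odd i.+1) (n./2 + i) <= #|B|.
  apply: leq_trans (sum_card_disjoint (P := P) (F := phi) _ disE); last first.
    by move=> i Pi; apply: bigcup_sup.
  apply: leq_sum => i _; have := size_ge v1 i (leq0n _); rewrite /= subn0; lia.
have cardE : #|xy_set n| <= #|~: B|.
  rewrite -sum1_card.
  apply: leq_trans (sum_card_disjoint
    (F := fun e : 'I_n * 'I_n => phi e.1 :&: phi e.2) _ _).
  - apply: leq_sum => -[x y]; rewrite inE /= => xy; rewrite card_gt0.
    have lt : x < y by move: xy; rewrite /xy_arc /inX /inY; lia.
    apply: (arcP _ _ lt _).1; move: xy; rewrite /xy_arc /asap_arc => ->.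
    by rewrite !orbT.
  (* A colour common to x, y and an even w would close a triangle: w, adjacent
     to both odd vertices, is next to each of them, whence y = x + 2. *)
  - move=> [x y]; rewrite inE /= => xy; apply/subsetP => c.
    rewrite !inE => /andP[cx cy].
    apply/bigcupP => -[w ew cw]; rewrite inE /= in ew.
    have [ox oy hx hy nxy] := xy_arcP xy.
    have key (z : 'I_n) : odd z.+1 -> c \in phi z ->
        asap_arc n w.+1 z.+1 || asap_arc n z.+1 w.+1.
      move=> oz cz; apply: contraLR cw; rewrite negb_or => /andP[n1 n2].
      have : z != w by apply: contraTneq oz => ->.
      rewrite -val_eqE neq_ltn => /orP[] lt.
        by rewrite (disjointFr (nonarcP _ _ lt n2)).
      by rewrite (disjointFl (nonarcP _ _ lt n1)).
    have /asap_arc_even_odd := key x ox cx.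
    have /asap_arc_even_odd := key y oy cy.
    move=> /(_ ew oy ltac:(lia)) hyw /(_ ew ox ltac:(lia)) hxw; lia.
  (* X and Y are independent, so a colour determines its end on each side. *)
  - move=> [x y] [x' y']; rewrite !inE /= => xy xy' ne.
    apply/pred0P => c /=; apply/negbTE; rewrite !inE.
    apply: contra ne => /andP[/andP[cx cy] /andP[cx' cy']].
    have key (z w : 'I_n) : odd z.+1 -> odd w.+1 ->
        (z < lastX n) = (w < lastX n) -> c \in phi z -> c \in phi w -> z = w.
      move=> oz ow side cz cw; apply/eqP/contraT.
      rewrite -val_eqE neq_ltn => /orP[] lt;
        have /nonarcP := lt;
        rewrite asap_arc_odd // xy_arc_same_side // => /(_ isT) dis.
        by rewrite (disjointFr dis cz) in cw.
      by rewrite (disjointFl dis cz) in cw.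
    have [ox oy hx hy _] := xy_arcP xy; have [ox' oy' hx' hy' _] := xy_arcP xy'.
    rewrite (key x x' ox ox' _ cx cx'); last by clear -hx hx'; lia.
    by rewrite (key y y' oy oy' _ cy cy'); last by clear -hy hy'; lia.
by rewrite /asap_din -(cardsC B) leq_add.
Qed.

(** * An optimal representation *)

(** The colours may be drawn from any larger type: only the size of the palette
    that is actually used counts. *)
Lemma restrict_rep (D : digraph) (U : finType) (phi : D -> {set U})
    (A : {set U}) :
  (forall v, phi v \subset A) -> dir_int_rep phi ->
  exists (C : finType) (psi : D -> {set C}), #|C| = #|A| /\ dir_int_rep psi.
Proof.
move=> phiA [phi0 phiE].
pose C := {x : U | x \in A}; pose r (X : {set U}) : {set C} := val @^-1: X.
have card_r (X : {set U}) : X \subset A -> #|r X| = #|X|.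
  move=> XA; rewrite -(card_imset _ val_inj); apply: eq_card => x.
  apply/imsetP/idP => [[y]|xX]; first by rewrite inE => yX ->.
  by exists (Sub x (subsetP XA x xX)); rewrite ?inE ?SubK.
exists C, (fun v => r (phi v)); split; first by rewrite card_sig.
split=> [v|u v /phiE ->]; first by rewrite -card_gt0 card_r ?card_gt0.
by rewrite -preimsetI !card_r // subIset // phiA.
Qed.

(** Which colours of the blocks go to the vertex of index v when d X-Y arcs are
    incident to it; (j, k) is the colour of rank k in the block of the even
    index j. Rank 0 of each block is kept for v_1, rank 1 for the odd vertex
    after the block, and the ranks from 2 on for the odd vertex before it, so
    that the set of an odd vertex has 1 + (n/2 + v - d - 2) + d = n/2 + v - 1
    elements. *)
Definition block_colour (n d v j k : nat) : bool :=
  if v == 1 then ~~ odd j && (k == 0)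
  else if odd v then
    (j == v - 1) && (k == 1) || (j == v + 1) && (2 <= k < n./2 + v - d)
  else (j == v) && (k < n./2 + v - 1).

(** Left summands are pairs of a vertex and a rank in its block, right summands
    are candidate X-Y arcs. Every block has fewer than 2n elements. *)
Definition colour (n : nat) : finType := (('I_n * 'I_n.*2) + ('I_n * 'I_n))%type.

Definition asap_rep (n : nat) (v : asap n) : {set colour n} :=
  [set c : colour n | match c with
           | inl p => block_colour n #|incident v| v.+1 p.1.+1 p.2
           | inr e => e \in incident v
           end].

Definition palette (n : nat) : {set colour n} :=
  [set c : colour n | match c with
           | inl p => ~~ odd p.1.+1 && (p.2 < n./2 + p.1)
           | inr e => e \in xy_set n
           end].

Lemma card_palette (n : nat) (n_even : ~~ odd n) : #|palette n| = asap_din n.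
Proof.
rewrite card_sum_set /asap_din; congr (_ + _); last first.
  by apply: eq_card => e; rewrite inE.
rewrite -sum1_card (eq_bigl (fun p : 'I_n * 'I_n.*2 =>
  ~~ odd p.1.+1 && (p.2 < n./2 + p.1))).
  rewrite -(pair_big_dep (fun i : 'I_n => ~~ odd i.+1)
    (fun (i : 'I_n) (k : 'I_n.*2) => k < n./2 + i) (fun _ _ => 1)) /=.
  apply: eq_bigr => i ei; rewrite sum1_card -[RHS]subn0.
  rewrite -(@card_ord_itv n.*2 0 (n./2 + i)); last by have := ltn_ord i; lia.
  by apply: eq_card => k; rewrite !inE.
by move=> p; rewrite inE.
Qed.

Lemma card_block_colour (n : nat) (n_ge8 : 8 <= n) (n_even : ~~ odd n)
    (v : 'I_n) :
  #|[set p : 'I_n * 'I_n.*2 |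
      block_colour n #|incident v| v.+1 p.1.+1 p.2]| + #|incident v|
  = n./2 + v.
Proof.
have dle := card_incident n_ge8 n_even v; have vn := ltn_ord v.
have inc0 : (v == 0 :> nat) || ~~ odd v.+1 -> #|incident v| = 0.
  move=> hv; apply/eqP; rewrite cards_eq0; apply/eqP/setP => -[i j].
  rewrite !inE /=.
  apply/negbTE/negP => /andP[/xy_arcP[oi oj hi hj _]].
  by case/orP => /eqP ev; move: hv; rewrite -ev; clear -oi oj hi hj; lia.
rewrite /block_colour; have [v1|v1] := boolP (v.+1 == 1).
  rewrite inc0; last by rewrite -eqSS v1.
  have n0 : 0 < n.*2 by lia.
  rewrite (_ : [set _ | _] =
    setX [set i : 'I_n | ~~ odd i.+1] [set Ordinal n0]).
    rewrite cardsX cards1 cardsE -sum1_card (sum_even_index (fun=> 1) n_even).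
    by rewrite sum_nat_const card_ord; lia.
  by apply/setP => -[i k]; rewrite !inE -val_eqE.
have [ov|ov] := boolP (odd v.+1).
  have v0 : v.-1 < n by lia.
  have v2 : v.+1 < n by lia.
  have k1 : 1 < n.*2 by lia.
  rewrite (_ : [set _ | _] = (Ordinal v0, Ordinal k1) |:
     setX [set Ordinal v2]
       [set k : 'I_n.*2 | 2 <= k < n./2 + v.+1 - #|incident v|]).
    rewrite cardsU1 cardsX cards1 card_ord_itv; last by lia.
    rewrite !inE /= andbF; move: #|incident v| dle v1 ov vn n_ge8.
    by clear => d dle v1 ov vn n8; lia.
  apply/setP => -[i k]; rewrite !inE xpair_eqE -!val_eqE /=.
  by congr (_ && _ || _ && _); lia.
rewrite (inc0 _); last by rewrite ov orbT.
rewrite (_ : [set _ | _] =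
  setX [set v] [set k : 'I_n.*2 | 0 <= k < n./2 + v.+1 - 1]).
  by rewrite cardsX cards1 card_ord_itv; lia.
by apply/setP => -[i k]; rewrite !inE -!val_eqE /= eqSS.
Qed.

Lemma card_asap_rep (n : nat) (n_ge8 : 8 <= n) (n_even : ~~ odd n)
    (v : 'I_n) :
  #|asap_rep v| = n./2 + v.
Proof.
rewrite -(card_block_colour n_ge8 n_even v) card_sum_set; congr (_ + _).
by apply: eq_card => e; rewrite inE.
Qed.

Lemma asap_rep_sub (n : nat) (n_ge8 : 8 <= n) (n_even : ~~ odd n)
    (v : asap n) :
  asap_rep v \subset palette n.
Proof.
apply/subsetP => -[[j k]|e]; rewrite !inE /=; last by case/andP.
rewrite /block_colour; case: ifP => v1; first by lia.
by case: ifP => ov; lia.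
Qed.

(** A colour of the block of j is shared only by v_j itself, by v_1 (rank 0), by
    v_{j+1} (rank 1) or by v_{j-1} (rank 2 or more), so any two vertices sharing
    one are joined by an arc from v_1 or an arc of the path. *)
Lemma common_colour (n d1 d2 u v j k : nat) : 0 < u < v ->
  block_colour n d1 u j k -> block_colour n d2 v j k -> asap_arc n u v.
Proof.
rewrite /block_colour => uv.
have -> : (v == 1) = false by lia.
suff h : ((u == 1) && ~~ odd v || (v == u + 1)) -> asap_arc n u v.
  case: ifP => u1; case: ifP => ov; [| |case: ifP => ou..] => hu hv; apply: h; lia.
by rewrite /asap_arc => /orP[->|->]; rewrite ?orbT.
Qed.

Lemma path_arc_common_colour (n d1 d2 u v : nat) :
  8 <= n -> d1 <= n./2 -> 0 < u < v -> v <= n ->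
  (u == 1) && ~~ odd v || (v == u + 1) ->
  exists j k, [/\ 0 < j <= n, k < n.*2,
    block_colour n d1 u j k & block_colour n d2 v j k].
Proof.
move=> n8 d1n uv vn a; rewrite /block_colour.
have -> : (v == 1) = false by lia.
have [u1|u1] := eqVneq u 1.
  have ev : ~~ odd v by lia.
  by exists v, 0; rewrite (negbTE ev) eqxx; split; lia.
have {a} vE : v = u + 1 by lia.
have [ou|eu] := boolP (odd u).
  (* Rank 2 is below the end of the range: 2 < n/2 + u - d1 as 3 <= u. *)
  exists v, 2; rewrite vE addn1 /= ou /=; split; lia.
by exists u, 1; rewrite vE addn1 /= eu; split; lia.
Qed.

Lemma asap_repP (n : nat) (n_ge8 : 8 <= n) (n_even : ~~ odd n) :
  dir_int_rep (@asap_rep n).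
Proof.
split=> [v|u v ne]; first by rewrite -card_gt0 card_asap_rep //; lia.
rewrite !card_asap_rep // ltn_add2l card_gt0.
rewrite /arc /= /asap_rel; split=> [a|[/set0Pn[c]]]; last first.
  rewrite !inE => + lt; case: c => [[j k] /andP[hu hv]|[x y]] /=.
    by apply: common_colour hu hv; rewrite ltnS.
  rewrite !inE /= => /andP[/andP[xy hu] /andP[_ hv]].
  have [_ _ hx hy _] := xy_arcP xy.
  have [xu yv] : x = u /\ y = v.
    case/orP: hu => /eqP hu; case/orP: hv => /eqP hv; subst; split=> //;
      by [move: ne; rewrite eqxx|move: lt hx hy; clear; lia].
  by rewrite -xu -yv /asap_arc; move: xy; rewrite /xy_arc => ->; rewrite !orbT.
have lt : u < v.
  by move: a ne; rewrite /asap_arc /inX /inY xpair_eqE -val_eqE /=; clear; lia.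
split=> //; apply/set0Pn.
have dle := card_incident n_ge8 n_even u.
rewrite /asap_arc orbA in a; case/orP: a => [a|xy].
  have uv : 0 < u.+1 < v.+1 by rewrite ltnS.
  have [[|j] [k [jn kn hu hv]]] :=
    path_arc_common_colour #|incident v| n_ge8 dle uv (ltn_ord v) a;
    first by [].
  by exists (inl (Ordinal jn, Ordinal kn)); rewrite !inE hu hv.
exists (inr (u, v)); rewrite !inE /= !eqxx orbT !andbT.
by rewrite /xy_arc xy.
Qed.

Lemma asap_is_DIN (n : nat) (n_ge8 : 8 <= n) (n_even : ~~ odd n) :
  is_DIN (asap n) (asap_din n).
Proof.
split; last by move=> C phi; apply: asap_din_le.
have [C [psi [cardC psiP]]] :=
  restrict_rep (asap_rep_sub n_ge8 n_even) (asap_repP n_ge8 n_even).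
by exists C, psi; rewrite cardC card_palette.
Qed.

(** * The closed formula *)

Local Open Scope ring_scope.

(** (p + q)^2 / 4 exceeds p q by (p - q)^2 / 4, which is 0 or 1/4. *)
Lemma floor_quarter (p q : nat) : (q <= p <= q.+1)%N ->
  Num.floor (((p + q)%:R ^+ 2 / 4%:R : rat)) = (p * q)%:Z.
Proof.
move=> pq; apply: floor_def.
have [->|->] : p = q \/ p = q.+1 by lia.
  by rewrite intrD -pmulrn natrM natrD; apply/andP; split; nra.
rewrite intrD -pmulrn natrM -addn1 !natrD.
have : 0 <= q%:R :> rat by [].
by move=> ?; apply/andP; split; nra.
Qed.

Theorem mainTheorem3 (n : nat) (hn : (8 <= n)%N) (hev : ~~ odd n) :
  exists k : nat, is_DIN (asap n) k /\
    k%:R = n%:R ^+ 2 / 2%:R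
           + (Num.floor (n%:R ^+ 2 / 16%:R - n%:R / 4%:R + 1 / 4%:R :> rat))%:~R
           - 1 :> rat.
Proof.
have [lo l1 l2 l3] := lastX_bounds hn hev.
exists (asap_din n); split; first exact: asap_is_DIN.
have := asap_dinE hn hev.
(* p and q are the cardinals of X and Y. *)
set p := (lastX n)./2; set q := (n./2 - 1 - p)%N => dinE.
have nE : n = (2 * (p + q + 1))%N by rewrite /q /p; lia.
have nR : n%:R = 2 * ((p + q)%:R + 1) :> rat.
  by rewrite nE natrM natrD.
have -> : n%:R ^+ 2 / 16%:R - n%:R / 4%:R + 1 / 4%:R
    = (p + q)%:R ^+ 2 / 4%:R :> rat.
  by rewrite nR; field.
rewrite floor_quarter; last by rewrite /q /p; lia.
move: (asap_din n) dinE => k dinE.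
have : k.+1%:R = (2 * n./2 ^ 2 + p * q)%:R :> rat by rewrite dinE.
have -> : n./2 = (p + q + 1)%N by move: nE; clear; lia.
rewrite nR -addn1 !(natrD, natrM, natrX) -pmulrn natrM => e.
have -> : k%:R = 2%:R * (p%:R + q%:R + 1) ^+ 2 + p%:R * q%:R - 1 :> rat.
  by rewrite -[LHS](addrK 1) e.
by field.
Qed.
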